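(* For every integer $n\geq 1$, $$A_{O\geq N}(n)-B_{O\geq N}(n)=D(n).$$
   Context: A partition of $n$ is a finite non-increasing sequence of positive integers (its parts) with sum $n$. An overpartition of $n$ is a partition of $n$ in which the first occurrence of each number may be overlined (so for each size $t$ at most one part of size $t$ is overlined); the size of a part $t$ or $\overline{t}$ is $t$, and the weight is the sum of sizes. For an overpartition $\pi$, let $SN(\pi)$ be the size of the smallest non-overlined part of $\pi$ if $\pi$ has non-overlined parts, and $SN(\pi)=0$ otherwise. Let $\ell_{O\geq N}(\pi)$ be the number of overlined parts of $\pi$ of size greater than or equal to $SN(\pi)$. $A_{O\geq N}(n)$ (resp. $B_{O\geq N}(n)$) is the number of overpartitions $\pi$ of $n$ such that $SN(\pi)\geq 1$ and $\ell_{O\geq N}(\pi)$ is even (resp. odd). $D(n)$ is the number of partitions of $n$ into distinct parts. *)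

(* Defs.v *)
From mathcomp Require Import all_boot all_order all_algebra.

Set Implicit Arguments.
Unset Strict Implicit.
Unset Printing Implicit Defensive.

Definition is_partition (n : nat) (s : seq nat) : bool :=
  [&& sorted geq s, 0 \notin s & sumn s == n].

(* The part (t, true) is the overlined part of size t, and (t, false) the
   non-overlined one. *)
Definition opart : Type := (nat * bool)%type.

Definition opsizes (s : seq opart) : seq nat := [seq x.1 | x <- s].

(* Only the first occurrence of a number may be overlined: a part preceded by
   another part of the same size is not overlined. *)
Definition is_overpartition (n : nat) (s : seq opart) : bool :=
  is_partition n (opsizes s)
  && pairwise (fun x y : opart => (x.1 == y.1) ==> ~~ y.2) s.

Definition nonoverlined (s : seq opart) : seq nat :=
  [seq x.1 | x <- s & ~~ x.2].

Definition overlined (s : seq opart) : seq nat :=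
  [seq x.1 | x <- s & x.2].

(* The default [head 0] gives the value 0 when there is no non-overlined part. *)
Definition SN (s : seq opart) : nat :=
  foldr minn (head 0 (nonoverlined s)) (nonoverlined s).

Definition ell_OgeN (s : seq opart) : nat :=
  count (fun t => SN s <= t) (overlined s).

(* A partition or overpartition of n has at most n parts, each of size at most
   n, so all of them occur in the finite types of bounded sequences used below
   (see [num_partitionsE] and [num_overpartitionsE]). *)
Definition num_partitions (n : nat) (P : pred (seq nat)) : nat :=
  #|[set s : n.-bseq 'I_n.+1 |
      is_partition n [seq val i | i <- s] && P [seq val i | i <- s]]|.

Definition opart_of (n : nat) (x : 'I_n.+1 * bool) : opart := (val x.1, x.2).

Definition num_overpartitions (n : nat) (P : pred (seq opart)) : nat :=
  #|[set s : n.-bseq ('I_n.+1 * bool)%type |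
      is_overpartition n (map (@opart_of n) s) && P (map (@opart_of n) s)]|.

Definition A_OgeN (n : nat) : nat :=
  num_overpartitions n (fun s => (1 <= SN s) && ~~ odd (ell_OgeN s)).

Definition B_OgeN (n : nat) : nat :=
  num_overpartitions n (fun s => (1 <= SN s) && odd (ell_OgeN s)).

Definition D (n : nat) : nat := num_partitions n uniq.

Lemma is_partition_bound n s :
  is_partition n s -> size s <= n /\ all (fun t => t < n.+1) s.
Proof.
case/and3P=> _ s0 /eqP <- {n}; split.
  elim: s s0 => //= a s IH; rewrite inE negb_or eq_sym -lt0n => /andP[a0 /IH].
  by rewrite -(add1n (size s)); apply: leq_add.
apply/allP=> t; elim: s {s0} => //= a s IH; rewrite inE ltnS => /orP[/eqP->|/IH].
  exact: leq_addr.
by rewrite ltnS => h; apply: leq_trans h (leq_addl _ _).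
Qed.

Lemma card_bseq_map (T : finType) (U : eqType) (f : T -> U) n
    (P : pred (seq U)) (L : seq (seq U)) :
  injective f -> uniq L -> (forall s, (s \in L) = P s) ->
  (forall s, P s -> size s <= n /\ exists s', s = map f s') ->
  #|[set s : n.-bseq T | P (map f s)]| = size L.
Proof.
move=> fI uL LP H.
pose E := [seq map f s | s : n.-bseq T in [set s : n.-bseq T | P (map f s)]].
have -> : #|[set s : n.-bseq T | P (map f s)]| = size E by rewrite size_map cardE.
apply/perm_size/uniq_perm => // [|s].
  rewrite map_inj_uniq ?enum_uniq // => x y /(inj_map fI) e; exact: val_inj.
rewrite LP; apply/idP/idP => [/mapP[x]|Ps]; first by rewrite mem_enum inE => ? ->.
have [sz [s' es]] := H _ Ps; rewrite es size_map in sz.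
apply/mapP; exists (Bseq sz); last by [].
by rewrite mem_enum inE /= -es.
Qed.

Lemma num_partitionsE n (P : pred (seq nat)) (L : seq (seq nat)) :
  uniq L -> (forall s, (s \in L) = is_partition n s && P s) ->
  num_partitions n P = size L.
Proof.
move=> uL LP; apply: card_bseq_map LP _ => //; first exact: val_inj.
move=> s /andP[/is_partition_bound[sz /allP b] _]; split=> //.
exists [seq inord t | t <- s]; rewrite -map_comp -[LHS]map_id.
by apply/eq_in_map => t /b tn /=; rewrite inordK.
Qed.

Lemma num_overpartitionsE n (P : pred (seq opart)) (L : seq (seq opart)) :
  uniq L -> (forall s, (s \in L) = is_overpartition n s && P s) ->
  num_overpartitions n P = size L.
Proof.
move=> uL LP; apply: card_bseq_map LP _ => //.
  by move=> [i b] [j c] [/val_inj-> ->].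
move=> s /andP[/andP[/is_partition_bound[sz /allP b] _] _].
rewrite size_map in sz; split=> //.
exists [seq (inord x.1, x.2) | x <- s]; rewrite -map_comp -[LHS]map_id.
apply/eq_in_map => -[t c] ts; rewrite /opart_of /= inordK //.
by apply: b; apply/mapP; exists (t, c).
Qed.

(* Main.v *)
Require Import Defs.
From mathcomp Require Import all_boot all_order all_algebra.

(** Toggling the overline of the largest part (the head of the sequence) is
    an involution on overpartitions.  When some later part is non-overlined it
    preserves [SN] and flips the parity of [ell_OgeN].  Otherwise, if
    [1 <= SN], only the head is non-overlined, so that the sizes are distinct
    and [ell_OgeN] is [0]; these survivors correspond to partitions into
    distinct parts. *)

Lemma leq_foldr_minn k x l :
  (k <= foldr minn x l) = (k <= x) && all (leq k) l.
Proof. by elim: l => [|a l IH] /=; rewrite ?andbT // leq_min IH andbCA. Qed.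

(** The seed of the fold is the head of the list, itself an entry, so it adds no constraint to the
    minimum. *)
Lemma leq_SN k s :
  nonoverlined s != [::] -> (k <= SN s) = all (leq k) (nonoverlined s).
Proof.
rewrite /SN leq_foldr_minn; case: (nonoverlined s) => //= a l _.
by rewrite andbA andbb.
Qed.

Lemma SN_gt0 n s :
  is_overpartition n s -> (0 < SN s) = (nonoverlined s != [::]).
Proof.
case/andP=> /and3P[_ s0 _] _; have [e|ne] := eqVneq (nonoverlined s) [::].
  by rewrite /SN e.
rewrite leq_SN //; apply/allP => t /mapP[x]; rewrite mem_filter => /andP[_ xs] ->.
by rewrite lt0n; apply: contraNneq s0 => <-; apply: map_f.
Qed.

Lemma SN_cons t b s :
  all (geq t) (opsizes s) -> nonoverlined s != [::] -> SN ((t, b) :: s) = SN s.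
Proof.
move=> /allP ts ne.
case: b => //; apply/eqP; rewrite eqn_leq.
(* Both values are compared through their lower bounds: a lower bound [k] of the tail satisfies
   [k <= x <= t] for any non-overlined size [x] in the tail. *)
have E k : (k <= SN ((t, false) :: s)) = (k <= SN s).
  rewrite !leq_SN //= andb_idl // => /allP h.
  have [x xs] : exists x, x \in nonoverlined s.
    by case: (nonoverlined s) ne => // a l _; exists a; rewrite mem_head.
  apply: leq_trans (h _ xs) (ts _ _).
  by case/mapP: xs => y; rewrite mem_filter => /andP[_ ys] ->; apply: map_f.
by rewrite -E leqnn E leqnn.
Qed.

Lemma SN_leq t s :
  all (geq t) (opsizes s) -> nonoverlined s != [::] -> SN s <= t.
Proof.
move=> ts ne; rewrite -(SN_cons t false s ts ne).
by have /esym := leq_SN (SN ((t, false) :: s)) ((t, false) :: s) isT;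
  rewrite leqnn /= => /andP[].
Qed.

Definition toggle_head (s : seq opart) : seq opart :=
  if s is (t, b) :: s' then (t, ~~ b) :: s' else s.

Definition has_tail_nonoverlined (s : seq opart) : bool :=
  nonoverlined (behead s) != [::].

Lemma toggle_headK : involutive toggle_head.
Proof. by case=> [|[t b] s] //=; rewrite negbK. Qed.

(** No part precedes the head, so the first-occurrence condition never inspects its overline. *)
Lemma toggle_head_overpartition n s :
  is_overpartition n (toggle_head s) = is_overpartition n s.
Proof. by case: s => [|[t b] s]. Qed.

Lemma toggle_head_tail s :
  has_tail_nonoverlined (toggle_head s) = has_tail_nonoverlined s.
Proof. by case: s => [|[t b] s]. Qed.

Lemma overpartition_cons_geq n t b s :
  is_overpartition n ((t, b) :: s) -> all (geq t) (opsizes s).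
Proof.
case/andP=> /and3P[+ _ _] _ => /=.
by rewrite path_sortedE => [/andP[]//|x y z yx zx]; apply: leq_trans zx yx.
Qed.

Lemma toggle_head_SN n s :
  is_overpartition n s -> has_tail_nonoverlined s ->
  SN (toggle_head s) = SN s.
Proof.
case: s => [|[t b] s] // /overpartition_cons_geq ts ne.
by rewrite /= !SN_cons.
Qed.

(** The head has size at least [SN s], which is unchanged, so toggling adds or removes exactly one
    counted part. *)
Lemma toggle_head_ell n s :
  is_overpartition n s -> has_tail_nonoverlined s ->
  odd (ell_OgeN (toggle_head s)) = ~~ odd (ell_OgeN s).
Proof.
move=> os ne; rewrite /ell_OgeN (toggle_head_SN n) //.
case: s os ne => [|[t b] s] // /overpartition_cons_geq ts ne.
rewrite SN_cons //; have SNt := SN_leq t s ts ne.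
by case: b {ne} => /=; rewrite SNt add1n /= ?negbK.
Qed.

(** Inverse of [opsizes] on the survivors of the involution. *)
Definition overline_tail (p : seq nat) : seq opart :=
  if p is t :: p' then (t, false) :: [seq (x, true) | x <- p'] else [::].

Lemma opsizes_overline_tail p : opsizes (overline_tail p) = p.
Proof. by case: p => //= t p; rewrite /opsizes -map_comp map_id. Qed.

(** As every part after the head is overlined, the first-occurrence condition forbids any repeated
    size. *)
Lemma overline_tail_overpartition n p :
  is_overpartition n (overline_tail p) = is_partition n p && uniq p.
Proof.
rewrite /is_overpartition opsizes_overline_tail; congr (_ && _).
case: p => //= t p; rewrite uniq_pairwise pairwise_map all_map; congr (_ && _).
rewrite -has_pred1 -all_predC.
by apply: eq_all => x /=; rewrite implybF eq_sym.
Qed.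

Lemma nonoverlined_overline_tail p : nonoverlined (overline_tail p) = take 1 p.
Proof. by case: p => //= t p; elim: p => //= x p; rewrite take0. Qed.

Lemma overlined_overline_tail p : overlined (overline_tail p) = behead p.
Proof.
by case: p => //= t p; elim: p => //= x p; rewrite /overlined /= => ->.
Qed.

Lemma has_tail_overline_tail p : has_tail_nonoverlined (overline_tail p) = false.
Proof. by case: p => //= t p; elim: p. Qed.

Lemma opsizesK s :
  nonoverlined s != [::] -> ~~ has_tail_nonoverlined s ->
  overline_tail (opsizes s) = s.
Proof.
case: s => [|[t b] s] // ne; rewrite /has_tail_nonoverlined /= negbK => /eqP e.
case: b ne => [|_] /=; first by rewrite /nonoverlined /= -/(nonoverlined s) e.
congr (_ :: _); elim: s e => //= -[x [] //] s IH /IH e.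
by rewrite e.
Qed.

(** Here [SN] is the size of the head, and distinctness makes every overlined part strictly
    smaller. *)
Lemma ell_overline_tail n p :
  is_overpartition n (overline_tail p) -> ell_OgeN (overline_tail p) = 0.
Proof.
case: p => // t p /[dup] /overpartition_cons_geq tp.
rewrite overline_tail_overpartition => /andP[_ /andP[tNp _]].
rewrite /ell_OgeN /SN nonoverlined_overline_tail overlined_overline_tail /=.
rewrite take0 /= minnn.
apply/eqP; rewrite -leqn0 leqNgt -has_count; apply/hasPn => x xp.
move: tp; rewrite /opsizes -map_comp map_id => /allP/(_ _ xp) /= xt.
by rewrite -ltnNge ltn_neqAle xt andbT; apply: contraNneq tNp => <-.
Qed.

(** A single list of all overpartitions turns both cardinalities into counts of predicates over
    it. *)
Lemma overpartitions_enum n :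
  exists2 L : seq (seq opart), uniq L & forall s, (s \in L) = is_overpartition n s.
Proof.
pose f := @opart_of n.
pose E := [seq map f s | s : n.-bseq ('I_n.+1 * bool)%type].
exists (undup (filter (is_overpartition n) E)); first exact: undup_uniq.
move=> s; rewrite mem_undup mem_filter; apply: andb_idr => os.
have /andP[/is_partition_bound[sz /allP b] _] := os.
have es : s = map f [seq (inord x.1, x.2) | x <- s].
  rewrite -map_comp -[LHS]map_id; apply/eq_in_map => -[t c] ts.
  by rewrite /f /opart_of /= inordK //; apply: b; apply/mapP; exists (t, c).
have sz' : size [seq (inord x.1 : 'I_n.+1, x.2) | x <- s] <= n.
  by rewrite size_map -(size_map fst).
by apply/mapP; exists (Bseq sz'); rewrite ?mem_enum.
Qed.

Theorem theorem2p11 (n : nat) (hn : 1 <= n) :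
  ((A_OgeN n)%:Z - (B_OgeN n)%:Z = (D n)%:Z)%R.
Proof.
have [L uL memL] := overpartitions_enum n.
have count_op P : num_overpartitions n P = count P L.
  rewrite -size_filter; apply: num_overpartitionsE; first exact: filter_uniq.
  by move=> s; rewrite mem_filter memL andbC.
set even_tail := fun s => has_tail_nonoverlined s && ~~ odd (ell_OgeN s).
set fixed := fun s => (nonoverlined s != [::]) && ~~ has_tail_nonoverlined s.
have tail_ne s : has_tail_nonoverlined s -> nonoverlined s != [::].
  by case: s => [|[t []] s].
have fixed_ell s : s \in L -> fixed s -> ell_OgeN s = 0.
  rewrite memL => os /andP[ne nt]; rewrite -(opsizesK s ne nt) in os *.
  exact: ell_overline_tail os.
(* Survivors have [ell_OgeN] equal to 0, hence even, so all of them are counted by [A_OgeN]. *)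
have AE : A_OgeN n = count even_tail L + count fixed L.
  rewrite /A_OgeN count_op -count_predUI.
  rewrite [X in _ + X](_ : _ = 0) ?addn0; last first.
    by apply/eqP; rewrite -leqn0 leqNgt -has_count; apply/hasPn => s _ /=;
      rewrite /even_tail /fixed; case: has_tail_nonoverlined; rewrite ?andbF.
  apply: eq_in_count => s sL /=; rewrite (SN_gt0 n) -?memL //.
  have := fixed_ell s sL; rewrite /even_tail /fixed.
  have [/tail_ne->|_] := boolP (has_tail_nonoverlined s); first by rewrite orbF.
  by case: (_ != _) => //= ->.
(* No survivor has odd [ell_OgeN], so [toggle_head] matches the odd class with [even_tail]. *)
have BE : B_OgeN n = count even_tail L.
  rewrite /B_OgeN count_op -!size_filter.
  rewrite -[RHS](size_map toggle_head); apply/perm_size/uniq_perm.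
  - exact: filter_uniq.
  - by rewrite (map_inj_uniq (inv_inj toggle_headK)) filter_uniq.
  move=> s; rewrite -{2}[s]toggle_headK (mem_map (inv_inj toggle_headK)).
  rewrite !mem_filter !memL toggle_head_overpartition.
  apply: andb_id2r => os; rewrite (SN_gt0 n) // /even_tail toggle_head_tail.
  have [tl|nt] := boolP (has_tail_nonoverlined s).
    by rewrite (toggle_head_ell n) // negbK tail_ne.
  have := fixed_ell s; rewrite memL /fixed nt andbT => /(_ os).
  by case: (_ != _) => //= ->.
have DE : D n = count fixed L.
  rewrite -size_filter -(size_map opsizes); apply: num_partitionsE.
    rewrite map_inj_in_uniq ?filter_uniq // => s s'; rewrite !mem_filter.
    by move=> /andP[/andP[? ?] _] /andP[/andP[? ?] _] e;
      rewrite -(opsizesK s) // -(opsizesK s') // e.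
  move=> p; rewrite -overline_tail_overpartition -memL.
  apply/mapP/idP => [[s]|pL].
    by rewrite mem_filter => /andP[/andP[? ?] sL] ->; rewrite opsizesK.
  exists (overline_tail p); last by rewrite opsizes_overline_tail.
  rewrite mem_filter pL /fixed has_tail_overline_tail nonoverlined_overline_tail.
  (* The empty partition would give no non-overlined part; its sum 0 contradicts [1 <= n]. *)
  case: p pL => //; rewrite memL /is_overpartition /is_partition /= andbT.
  by rewrite eq_sym => /eqP n0; rewrite n0 in hn.
by rewrite AE BE DE PoszD GRing.addrC GRing.addKr.
Qed.
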